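(* Let $h,n,k$ be positive integers with $n-k\geq 2h$. There exists a $q$-linear code with parameters $[n,k,d]$ such that $d\geq 2h+1$ if and only if there exists an $S_h$-linear set with $n+1$ elements in $\mathbb{F}_q^{n-k}$.
   Context: An $[n,k,d]$ $q$-linear code is a $k$-dimensional subspace $\mathcal{C}$ of $\mathbb{F}_q^n$ whose minimum distance $d$ (the minimum Hamming weight, i.e. number of non-zero coordinates, of a non-zero codeword) equals $d$. For a non-empty subset $A$ of $\mathbb{F}_q^r$ and a positive integer $h\leq|A|$, an $h$-linear combination of $A$ is an expression $\lambda_1\boldsymbol{a}_1+\cdots+\lambda_h\boldsymbol{a}_h$ with $\lambda_i\in\mathbb{F}_q^*$ and $\boldsymbol{a}_1,\dots,\boldsymbol{a}_h$ distinct elements of $A$. $A$ is an $S_h$-linear set if all $h$-linear combinations of elements of $A$, omitting permutations of the summands, yield distinct elements of $\mathbb{F}_q^r$ (combinations differing only in the scalar attached to $\boldsymbol{0}$ being regarded as the same). *)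

(* Defs.v *)
From HB Require Import structures.
From mathcomp Require Import all_boot all_order all_algebra.

Set Implicit Arguments.
Unset Strict Implicit.
Unset Printing Implicit Defensive.

Import GRing.Theory.
Local Open Scope ring_scope.

Definition hamming_weight (F : finFieldType) (n : nat) (v : 'rV[F]_n) : nat :=
  #|[set i : 'I_n | v 0 i != 0]|.

Definition is_min_distance (F : finFieldType) (n : nat)
    (C : {vspace 'rV[F]_n}) (d : nat) : Prop :=
  (exists c, [/\ c \in C, c != 0 & hamming_weight c = d]) /\
  (forall c, c \in C -> c != 0 -> (d <= hamming_weight c)%N).

Definition linear_code (F : finFieldType) (n k d : nat)
    (C : {vspace 'rV[F]_n}) : Prop :=
  \dim C = k /\ is_min_distance C d.

(* The expression l_1 *: a_1 + ... + l_h *: a_h is represented by the sequence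
   of its summands (l_i, a_i), so that it is kept apart from its value. *)
Definition linear_combination (F : finFieldType) (r h : nat)
    (A : {set 'rV[F]_r}) (s : seq (F * 'rV[F]_r)) : Prop :=
  [/\ size s = h,
      uniq [seq p.2 | p <- s] &
      forall p, p \in s -> p.1 != 0 /\ p.2 \in A].

Definition combination_value (F : finFieldType) (r : nat)
    (s : seq (F * 'rV[F]_r)) : 'rV[F]_r :=
  \sum_(p <- s) p.1 *: p.2.

(* Sets the scalar attached to the zero vector to 1, so that it is ignored
   when expressions are compared. *)
Definition forget_zero_scalar (F : finFieldType) (r : nat)
    (p : F * 'rV[F]_r) : F * 'rV[F]_r :=
  if p.2 == 0 then (1, 0) else p.

Definition same_combination (F : finFieldType) (r : nat)
    (s t : seq (F * 'rV[F]_r)) : Prop :=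
  perm_eq (map (@forget_zero_scalar F r) s) (map (@forget_zero_scalar F r) t).

(* The bounds on h imply that A is non-empty. *)
Definition S_linear_set (F : finFieldType) (r h : nat)
    (A : {set 'rV[F]_r}) : Prop :=
  (0 < h <= #|A|)%N /\
  forall s t, linear_combination h A s -> linear_combination h A t ->
    ~ same_combination s t -> combination_value s <> combination_value t.

(* Main.v *)
Require Import Defs.
From HB Require Import structures.
From mathcomp Require Import all_boot all_order all_algebra.
From mathcomp Require Import zify.

(** Put the vectors of a set as the rows of a matrix [H]: the left kernel of [H]
    is a code with minimum distance at least [2h + 1] exactly when every linear
    relation between the rows has more than [2h] terms. Given a code, the rows of
    such an [H] together with [0] form an [S_h]-linear set, as the difference of
    two [h]-linear combinations is a relation with at most [2h] non-zero terms.

    Conversely, let [A] be [S_h]-linear with [n + 1] elements. A relation with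
    an even number [2j <= 2h] of terms splits into two [j]-linear combinations of
    equal value, and these become [h]-linear after adding [h - j] common
    terms; so there is none. Odd relations are reduced to this situation by
    - adding the term [0], if [0] is in [A];
    - translating [A] so that it contains [0], if [F] has two elements;
    - otherwise writing one coefficient as a difference of two non-zero
      scalars, so that its vector occurs on both sides. *)

Set Implicit Arguments.
Unset Strict Implicit.
Unset Printing Implicit Defensive.

Import GRing.Theory.
Local Open Scope ring_scope.

Lemma exists_subset_card (T : finType) (A : {set T}) (m : nat) :
  (m <= #|A|)%N -> exists2 B : {set T}, B \subset A & #|B| = m.
Proof.
move=> lemA; exists [set x in take m (enum A)].
  by apply/subsetP => x; rewrite inE => /mem_take; rewrite mem_enum.
rewrite cardsE (card_uniqP _) ?take_uniq ?enum_uniq //.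
by rewrite size_takel // -cardE.
Qed.

(** * Linear combinations as coefficient functions on the whole space *)

Section Combinations.

Variables (F : finFieldType) (r : nat).
Implicit Types (A : {set 'rV[F]_r}) (s t : seq (F * 'rV[F]_r)).
Implicit Types (a b : 'rV[F]_r) (c f g : 'rV[F]_r -> F).

(** A combination is handled as a function giving each vector its coefficient, so that the order of
    summands disappears and differences of combinations are pointwise. *)
Definition csupp c : {set 'rV[F]_r} := [set a | c a != 0].

Definition cval c : 'rV[F]_r := \sum_a c a *: a.

Definition seq_of_coef c : seq (F * 'rV[F]_r) :=
  [seq (c a, a) | a <- enum (csupp c)].

Definition coef_of_seq s a : F := \sum_(p <- s | p.2 == a) p.1.

Lemma notin_csupp A c a : csupp c \subset A -> a \notin A -> c a = 0.
Proof.
move=> /subsetP sA aA; apply/eqP; apply: contraNT aA => ca.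
by apply: sA; rewrite inE.
Qed.

Lemma seq_of_coef_combination A c :
  csupp c \subset A -> linear_combination #|csupp c| A (seq_of_coef c).
Proof.
move=> /subsetP sA; split.
- by rewrite size_map -cardE.
- by rewrite -map_comp map_id enum_uniq.
- move=> p /mapP[a]; rewrite mem_enum => ac -> /=.
  by split; [move: ac; rewrite inE | apply: sA].
Qed.

Lemma seq_of_coef_value c : combination_value (seq_of_coef c) = cval c.
Proof.
rewrite /combination_value big_map big_enum /= /cval.
rewrite [RHS](bigID (mem (csupp c))) /= [X in _ + X]big1 ?addr0 // => a.
by rewrite inE negbK => /eqP ->; rewrite scale0r.
Qed.

Lemma mem_seq_of_coef c a x : a != 0 ->
  ((x, a) \in map (@forget_zero_scalar F r) (seq_of_coef c)) =
  (x == c a) && (c a != 0).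
Proof.
move=> a0; apply/mapP/andP => [[p /mapP[b]]|[/eqP-> ca]].
  rewrite mem_enum inE => cb -> /=; rewrite /forget_zero_scalar /=.
  case: eqP => [_ [_ E]|_ [-> ->]]; first by rewrite E eqxx in a0.
  by rewrite eqxx.
exists (c a, a); last by rewrite /forget_zero_scalar /= (negPf a0).
by apply/mapP; exists a; rewrite // mem_enum inE.
Qed.

Lemma same_combination_coef f g a :
  same_combination (seq_of_coef f) (seq_of_coef g) -> a != 0 -> f a = g a.
Proof.
move=> /perm_mem E a0.
have := E (f a, a); rewrite !mem_seq_of_coef // eqxx /=.
have := E (g a, a); rewrite !mem_seq_of_coef // eqxx /=.
have [->|fa] := eqVneq (f a) 0; last by move=> _ /esym /andP[/eqP].
by rewrite andbF => /esym /negbFE /eqP ->.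
Qed.

(** The contrapositive of the defining property, read on coefficients. Nothing is claimed at the
    zero vector, whose scalar is forgotten when expressions are compared. *)
Lemma S_linear_coef_eq h A f g : S_linear_set h A ->
    csupp f \subset A -> csupp g \subset A ->
    #|csupp f| = h -> #|csupp g| = h -> cval f = cval g ->
  forall a, a != 0 -> f a = g a.
Proof.
move=> [_ SA] fA gA fh gh efg a; apply: same_combination_coef.
have := SA (seq_of_coef f) (seq_of_coef g).
rewrite -{1}fh -gh !seq_of_coef_value => /(_ (seq_of_coef_combination fA)).
move=> /(_ (seq_of_coef_combination gA)) S.
by apply/negP => /negP N; apply: S efg; apply/negP.
Qed.

(* Common terms outside both supports complete the two sides to [h] terms. *)
Lemma S_linear_coef_eq_pad h A f g j : S_linear_set h A ->
    csupp f \subset A -> csupp g \subset A ->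
    #|csupp f| = j -> #|csupp g| = j -> (j <= h)%N ->
    (#|csupp f :|: csupp g| + (h - j) <= #|A|)%N -> cval f = cval g ->
  forall a, a != 0 -> f a = g a.
Proof.
move=> SA fA gA fj gj jh szA efg a a0.
have UA : csupp f :|: csupp g \subset A by rewrite subUset fA gA.
have [|P PA Pc] := @exists_subset_card _ (A :\: (csupp f :|: csupp g)) (h - j).
  by rewrite cardsD (setIidPr UA); lia.
pose pad c b : F := c b + (b \in P)%:R.
have padS c : csupp c \subset csupp f :|: csupp g ->
    csupp (pad c) = csupp c :|: P /\ [disjoint csupp c & P].
  move=> /subsetP cU; split; last first.
    rewrite disjoint_sym disjoint_subset; apply/subsetP => b /(subsetP PA).
    rewrite in_setD => /andP[bU _]; change (b \notin csupp c).
    by apply: contra bU; apply: cU.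
  apply/setP => b; rewrite !inE /pad; case: (boolP (b \in P)) => bP; last first.
    by rewrite addr0 orbF.
  have := subsetP PA _ bP; rewrite inE => /andP[bU _].
  by rewrite (notin_csupp (introT subsetP cU) bU) add0r oner_eq0 orbT.
have padA c : csupp c \subset csupp f :|: csupp g -> csupp (pad c) \subset A.
  move=> cU; rewrite (padS c cU).1 subUset (subset_trans cU UA) /=.
  by apply: subset_trans PA _; apply: subsetDl.
have padh c : csupp c \subset csupp f :|: csupp g -> #|csupp c| = j ->
    #|csupp (pad c)| = h.
  move=> cU cj; have [-> d] := padS c cU.
  by rewrite cardsU (disjoint_setI0 d) cards0 cj Pc; lia.
have padv c : cval (pad c) = cval c + \sum_b (b \in P)%:R *: b.
  by rewrite /cval -big_split; apply: eq_bigr => b _; rewrite scalerDl.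
have := S_linear_coef_eq SA (padA _ (subsetUl _ _)) (padA _ (subsetUr _ _)).
move=> /(_ (padh _ (subsetUl _ _) fj) (padh _ (subsetUr _ _) gj)).
rewrite !padv efg => /(_ erefl a a0); exact: addIr.
Qed.

(** * Short linear relations inside an $S_h$-linear set *)

Lemma csupp_restrict (J : {set 'rV[F]_r}) c :
  csupp (fun b => if b \in J then c b else 0) = csupp c :&: J.
Proof. by apply/setP => b; rewrite !inE; case: (b \in J); rewrite ?eqxx ?andbT ?andbF. Qed.

(** Half of the terms stay on the left as [f], the others move to the right with opposite sign as
    [g]. With $2j$ terms in all, the padding needs $2j + (h - j) = h + j \leq 2h$ elements of
    [A]. *)
Lemma S_linear_no_even_relation h A c : S_linear_set h A -> (2 * h <= #|A|)%N ->
    csupp c \subset A -> (#|csupp c| <= 2 * h)%N -> ~~ odd #|csupp c| ->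
    cval c = 0 -> forall a, a != 0 -> c a = 0.
Proof.
move=> SA szA cA ch ce c0.
have [j cj] : exists j, #|csupp c| = (2 * j)%N.
  by exists (#|csupp c|)./2; lia.
have [|J JS Jj] := @exists_subset_card _ (csupp c) j; first by lia.
pose f b := if b \in J then c b else 0.
pose g b := if b \in ~: J then - c b else 0.
have sf : csupp f = J by rewrite csupp_restrict (setIidPr JS).
have sg : csupp g = csupp c :\: J.
  rewrite /g (csupp_restrict _ (fun b => - c b)) setDE; congr (_ :&: _).
  by apply/setP => b; rewrite !inE oppr_eq0.
have dfg b : c b = f b - g b.
  by rewrite /f /g inE; case: (b \in J); rewrite /= ?subr0 ?sub0r ?opprK.
have efg : cval f = cval g.
  apply/eqP; rewrite -subr_eq0 -[0]c0 /cval -sumrB; apply/eqP.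
  by apply: eq_bigr => b _; rewrite dfg scalerBl.
have gj : #|csupp g| = j by rewrite sg cardsD (setIidPr JS); lia.
have JA := subset_trans JS cA.
have gA : csupp g \subset A by rewrite sg (subset_trans (subsetDl _ _) cA).
move=> a a0; rewrite dfg; apply/eqP; rewrite subr_eq0; apply/eqP.
apply: (S_linear_coef_eq_pad (j := j) SA) => //; rewrite ?sf //; first by lia.
rewrite sg -{1}(setIidPr JS) setID; lia.
Qed.

(** A scalar [x] other than 0 and 1 splits [c b] as [x * c b - (x - 1) * c b] with both parts
    non-zero, so $2j + 1$ terms give two sides of $j + 1$ terms sharing [b]. Equality of the two
    coefficients at [b] would force [c b = 0]. *)
Lemma S_linear_no_odd_relation h A c (x : F) : S_linear_set h A ->
    (2 * h <= #|A|)%N -> 0 \notin A -> x != 0 -> x != 1 ->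
    csupp c \subset A -> (#|csupp c| <= 2 * h)%N -> odd #|csupp c| ->
    cval c <> 0.
Proof.
move=> SA szA A0 x0 x1 cA ch co c0.
have [j cj] : exists j, #|csupp c| = (2 * j).+1.
  by exists (#|csupp c|)./2; lia.
have /card_gt0P[b bc] : (0 < #|csupp c|)%N by lia.
have cb0 : c b != 0 by rewrite inE in bc.
have bA := subsetP cA _ bc.
have b0 : b != 0 by apply: contraNneq A0 => <-.
have Db := cardsD1 b (csupp c); rewrite bc cj in Db.
have [|J JS Jj] := @exists_subset_card _ (csupp c :\ b) j; first by lia.
have bJ : b \notin J by apply/negP => /(subsetP JS); rewrite !inE eqxx.
have JS' : J \subset csupp c by apply: subset_trans JS (subD1set _ _).
pose f a := if a == b then x * c b else if a \in J then c a else 0.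
pose g a := if a == b then (x - 1) * c b else if a \in J then 0 else - c a.
have sf : csupp f = b |: J.
  apply/setP => a; rewrite !inE /f; case: (eqVneq a b) => [->|_] /=.
    by rewrite mulf_neq0.
  case: (boolP (a \in J)) => [/(subsetP JS')|_]; last by rewrite eqxx.
  by rewrite inE.
have sg : csupp g = csupp c :\: J.
  apply/setP => a; rewrite !inE /g; case: (eqVneq a b) => [->|_] /=.
    by rewrite mulf_neq0 ?subr_eq0 // bJ cb0.
  by case: (a \in J); rewrite /= ?eqxx ?oppr_eq0.
have dfg a : c a = f a - g a.
  rewrite /f /g; case: eqP => [->|_]; last first.
    by case: ifP; rewrite ?subr0 ?sub0r ?opprK.
  by rewrite -mulrBl opprB addrC subrK mul1r.
have efg : cval f = cval g.
  apply/eqP; rewrite -subr_eq0 -[0]c0 /cval -sumrB; apply/eqP.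
  by apply: eq_bigr => a _; rewrite dfg scalerBl.
have fj : #|csupp f| = j.+1 by rewrite sf cardsU1 bJ Jj.
have gj : #|csupp g| = j.+1.
  by rewrite sg cardsD (setIidPr JS') cj Jj; clear; lia.
have fS : csupp f \subset csupp c by rewrite sf subUset JS' sub1set bc.
have gS : csupp g \subset csupp c by rewrite sg subsetDl.
have US : (#|csupp f :|: csupp g| <= #|csupp c|)%N.
  by apply: subset_leq_card; rewrite subUset fS gS.
have E : f b = g b.
  apply: (S_linear_coef_eq_pad (j := j.+1) SA) => //.
  - exact: subset_trans fS cA.
  - exact: subset_trans gS cA.
  - by move: ch; rewrite cj; clear; lia.
  - by move: US ch szA; rewrite cj; clear; lia.
by have := dfg b; rewrite E subrr => E0; rewrite E0 eqxx in cb0.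
Qed.

(** * Translating the set and discarding one element *)

Lemma cval_shift b c :
  \sum_a c a *: (a - b) = cval c - (\sum_a c a) *: b.
Proof.
rewrite scaler_suml -sumrB; apply: eq_bigr => a _; exact: scalerBr.
Qed.

Lemma sum_indicator b (x : F) : \sum_a (if a == b then x else 0) = x.
Proof. by rewrite -big_mkcond big_pred1_eq. Qed.

Lemma cval_addpoint b x c :
  cval (fun a => c a + if a == b then x else 0) = cval c + x *: b.
Proof.
rewrite /cval (eq_bigr (fun a => c a *: a + if a == b then x *: b else 0)).
  by rewrite big_split /= -big_mkcond big_pred1_eq.
by move=> a _; rewrite scalerDl; case: eqP => [->|_]; rewrite ?scale0r.
Qed.

Lemma csupp_addpoint_sub b x c :
  csupp (fun a => c a + if a == b then x else 0) \subset b |: csupp c.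
Proof.
apply/subsetP => a; rewrite !inE; case: (eqVneq a b) => //= _; by rewrite addr0.
Qed.

(** Here [b0] is the discarded element and [b] the translation vector. The cases differ in how
    relations with an odd number of terms are excluded. *)
Lemma S_linear_shift_independent h A : S_linear_set h A -> (2 * h < #|A|)%N ->
  exists b0 b, b0 \in A /\ forall c, csupp c \subset A :\ b0 ->
    (#|csupp c| <= 2 * h)%N -> \sum_a c a *: (a - b) = 0 ->
    forall a, c a = 0.
Proof.
move=> SA szA; have szA' := ltnW szA.
have cD b0 c : csupp c \subset A :\ b0 -> csupp c \subset A /\ c b0 = 0.
  move=> cS; split; first exact: subset_trans cS (subD1set _ _).
  by apply: notin_csupp cS _; rewrite !inE eqxx.
have [A0|A0] := boolP (0 \in A).
  exists 0, 0; split=> // c /[dup] cS /cD[cA c0] ch.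
  rewrite cval_shift scaler0 subr0 => cv a.
  have [->//|a0] := eqVneq a 0.
  have [co|ce] := boolP (odd #|csupp c|); last exact: S_linear_no_even_relation SA szA' cA ch ce cv a a0.
  (* Zero was discarded, so [c] vanishes there; the extra term [1 *: 0] keeps the value and makes
     the number of terms even. An odd number up to $2h$ is below $2h$, so the bound survives. *)
  pose c' b := c b + if b == 0 then 1 else 0.
  have sc' : csupp c' = 0 |: csupp c.
    apply/setP => b; rewrite !inE /c'; case: (eqVneq b 0) => [->|_]; last by rewrite addr0.
    by rewrite c0 add0r oner_eq0.
  have nc' : #|csupp c'| = #|csupp c|.+1 by rewrite sc' cardsU1 inE c0 eqxx.
  have := @S_linear_no_even_relation h A c' SA szA'; rewrite nc' => /(_ _ _ _ _ a a0).
  rewrite /c' (negPf a0) addr0; apply; last by rewrite cval_addpoint cv scaler0 addr0.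
  - by rewrite sc' subUset sub1set A0.
  - lia.
  - by rewrite /= co.
have /card_gt0P[b0 b0A] : (0 < #|A|)%N by lia.
have c00 c : csupp c \subset A -> c 0 = 0 by move=> cA; apply: notin_csupp cA A0.
have [/forallP F2|] := boolP [forall x : F, (x == 0) || (x == 1)]; last first.
  rewrite negb_forall => /existsP[x]; rewrite negb_or => /andP[x0 x1].
  exists b0, 0; split=> // c /cD[cA _] ch.
  rewrite cval_shift scaler0 subr0 => cv a.
  have [->|a0] := eqVneq a 0; first exact: c00.
  have [co|ce] := boolP (odd #|csupp c|); last exact: S_linear_no_even_relation SA szA' cA ch ce cv a a0.
  by case: (S_linear_no_odd_relation SA szA' A0 x0 x1 cA ch co cv).
exists b0, b0; split=> // c /cD[cA cb0] ch; rewrite cval_shift => cv a.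
(* Over the field with two elements, the coefficient at [b0] is chosen to make the coefficients sum
   to zero. The relation between translated vectors becomes one between elements of [A], and its
   number of terms is even, hence at most $2h$ although [b0] may have been added. *)
pose c' b := c b + if b == b0 then - (\sum_b c b) else 0.
have sc' := csupp_addpoint_sub b0 (- (\sum_b c b)) c; rewrite -/c' in sc'.
have c'A : csupp c' \subset A by apply: subset_trans sc' _; rewrite subUset sub1set b0A.
have c'h : (#|csupp c'| <= (2 * h).+1)%N.
  by apply: leq_trans (subset_leq_card sc') _; rewrite cardsU1 inE cb0 eqxx; lia.
have c'v : cval c' = 0 by rewrite cval_addpoint scaleNr.
have two0 : 1 + 1 = 0 :> F.
  case/orP: (F2 (1 + 1)) => /eqP // E.
  by have := oner_eq0 F; rewrite -(subrr 1) -[X in _ == X - _]E addrK eqxx.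
have c's : \sum_b c' b = 0 by rewrite big_split /= sum_indicator subrr.
have c'e : ~~ odd #|csupp c'|.
  apply/negP => co.
  (* Every coefficient is 0 or 1, so their sum counts the support modulo 2. *)
  have : \sum_b c' b = #|csupp c'|%:R.
    rewrite -sumr_const [RHS]big_mkcond /=; apply: eq_bigr => b _; rewrite inE.
    by case/orP: (F2 (c' b)) => /eqP ->; rewrite ?eqxx ?oner_eq0.
  rewrite c's -(odd_double_half #|csupp c'|) co -muln2 natrD natrM.
  by rewrite [2%:R]two0 mulr0 addr0 => /esym/eqP; rewrite oner_eq0.
have [->|a0] := eqVneq a 0; first exact: c00.
have [->//|ab] := eqVneq a b0.
have c'h2 : (#|csupp c'| <= 2 * h)%N by lia.
by have := S_linear_no_even_relation SA szA' c'A c'h2 c'e c'v a0; rewrite /c' (negPf ab) addr0.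
Qed.

(** * From sequences of summands to coefficient functions *)

Lemma coef_of_seq_mem s p : uniq [seq q.2 | q <- s] -> p \in s ->
  coef_of_seq s p.2 = p.1.
Proof.
rewrite /coef_of_seq; elim: s => //= q s IH /andP[qs us].
rewrite inE big_cons => /orP[/eqP ->|ps].
  rewrite eqxx big1_seq ?addr0 // => p' /andP[/eqP E p's].
  by case/negP: qs; rewrite -E; apply: map_f.
have -> : (q.2 == p.2) = false.
  by apply: contraNF qs => /eqP ->; apply: map_f.
exact: IH.
Qed.

Lemma coef_of_seq_neq0 s a : coef_of_seq s a != 0 -> a \in [seq q.2 | q <- s].
Proof.
apply: contraR => aN; rewrite /coef_of_seq big1_seq // => p /andP[/eqP E ps].
by case/negP: aN; rewrite -E; apply: map_f.
Qed.

Lemma cval_coef_of_seq s : cval (coef_of_seq s) = combination_value s.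
Proof.
rewrite /cval /combination_value.
under eq_bigr do rewrite /coef_of_seq scaler_suml.
rewrite (exchange_big_dep xpredT) //=; apply: eq_bigr => p _.
by rewrite (eq_bigl (pred1 p.2)) ?big_pred1_eq // => a; rewrite /= eq_sym.
Qed.

Lemma csupp_coef_of_seq h A s : linear_combination h A s ->
  csupp (coef_of_seq s) \subset A /\ (#|csupp (coef_of_seq s)| <= h)%N.
Proof.
case=> <- us sA; split.
  apply/subsetP => a; rewrite inE => /coef_of_seq_neq0 /mapP[p ps ->].
  by case: (sA p ps).
rewrite -(size_map (fun q => q.2)); apply: leq_trans (card_size _).
by apply: subset_leq_card; apply/subsetP => a; rewrite inE => /coef_of_seq_neq0.
Qed.

(** Summands at non-zero vectors are determined by the coefficients. The remaining ones all become
    [(1, 0)], and both sequences have equally many of them because both have length [h]. *)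
Lemma same_combination_of_coef h A s t :
    linear_combination h A s -> linear_combination h A t ->
    (forall a, a != 0 -> coef_of_seq s a = coef_of_seq t a) ->
  same_combination s t.
Proof.
move=> cs ct est.
pose nz (p : F * 'rV[F]_r) := p.2 != 0.
have sub u v : linear_combination h A u -> linear_combination h A v ->
    (forall a, a != 0 -> coef_of_seq u a = coef_of_seq v a) ->
    {subset filter nz u <= filter nz v}.
  move=> [_ uu uA] [_ uv _] e p; rewrite !mem_filter => /andP[p0 pu].
  rewrite p0 /=; have := e _ p0; rewrite (coef_of_seq_mem uu pu) => E.
  have : coef_of_seq v p.2 != 0 by rewrite -E; case: (uA p pu).
  move=> /coef_of_seq_neq0 /mapP[p' p'v e2].
  move: E; rewrite e2 (coef_of_seq_mem uv p'v) => e1.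
  by rewrite (surjective_pairing p) e1 e2 -surjective_pairing.
have pnz : perm_eq (filter nz s) (filter nz t).
  case: (cs) (ct) => [_ us _] [_ ut _].
  apply: uniq_perm; rewrite ?filter_uniq ?(map_uniq us) ?(map_uniq ut) //.
  move=> p; apply/idP/idP; first exact: sub p.
  by apply: sub => // a /est.
pose z u := map (@forget_zero_scalar F r) (filter (predC nz) u).
have zeros u : z u = nseq (size u - size (filter nz u)) (1, 0).
  have <- : size (z u) = (size u - size (filter nz u))%N.
    by rewrite size_map !size_filter -(count_predC nz u); lia.
  apply/all_pred1P; rewrite all_map; apply/allP => p.
  rewrite mem_filter /= /forget_zero_scalar negbK => /andP[-> _].
  exact: eqxx.
have split u : perm_eq (map (@forget_zero_scalar F r) u)
    (map (@forget_zero_scalar F r) (filter nz u) ++ z u).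
  by rewrite -map_cat; apply: perm_map; rewrite perm_sym; apply/permPl/perm_filterC.
rewrite /same_combination (permPl (split s)) perm_sym (permPl (split t)) perm_sym.
rewrite !zeros (perm_size pnz); case: cs ct => [-> _ _] [-> _ _].
by rewrite perm_cat2r; apply: perm_map.
Qed.

End Combinations.

(** * Linear codes and left kernels of matrices *)

Section Codes.

Variables (F : finFieldType) (n : nat).
Implicit Types (C : {vspace 'rV[F]_n}).

(** For a generator matrix [M] of the code, [cokermx M] annihilates exactly the row space of [M]; a
    column base of it has $n - k$ columns and the same left kernel. *)
Lemma parity_check_matrix C k : \dim C = k ->
  exists H : 'M[F]_(n, n - k), forall v, v *m H = 0 -> v \in C.
Proof.
move=> <-; pose M : 'M[F]_(\dim C, n) := \matrix_i (vbasis C)`_i.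
have mulM (D : 'rV_(\dim C)) : D *m M = \sum_i D 0 i *: (vbasis C)`_i.
  by rewrite mulmx_sum_row; apply: eq_bigr => i _; rewrite rowK.
have MC : \rank M = \dim C.
  apply/eqP; rewrite -/(row_free M) -kermx_eq0; apply/rowV0P => D /sub_kermxP.
  rewrite mulM => D0; apply/rowP => i; rewrite mxE.
  by move/freeP: (basis_free (vbasisP C)) => /(_ (fun i => D 0 i) D0 i).
rewrite -[X in (n - X)%N]MC -mxrank_coker; exists (col_base (cokermx M)) => v v0.
have /submxP[D ->] : (v <= M)%MS.
  by rewrite submxE -(mulmx_base (cokermx M)) mulmxA v0 mul0mx.
rewrite mulM; apply: memv_suml => i _; apply: memvZ; apply: vbasis_mem.
by rewrite mem_nth // size_tuple.
Qed.

(** By rank-nullity the left kernel has dimension at least $n - r \geq k$; the first [k] vectors of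
    a basis span a subspace of dimension exactly [k]. *)
Lemma left_kernel_code (r : nat) (H : 'M[F]_(n, r)) (k : nat) : (k + r <= n)%N ->
  exists C, \dim C = k /\ forall v, v \in C -> v *m H = 0.
Proof.
move=> krn; pose f : 'Hom('rV[F]_n, 'rV[F]_r) := linfun (mulmxr H).
have kf : (k <= \dim (lker f))%N.
  have := limg_ker_dim f fullv; rewrite capfv dimvf /dim /= mul1n.
  have := dimvS (subvf (f @: fullv)%VS); rewrite dimvf /dim /= mul1n; lia.
have fr := basis_free (vbasisP (lker f)).
exists <<take k (vbasis (lker f))>>%VS; split.
  have : free (take k (vbasis (lker f))).
    by move: fr; rewrite -{1}(cat_take_drop k (vbasis (lker f))) cat_free => /andP[].
  by rewrite /free => /eqP ->; rewrite size_takel // size_tuple.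
move=> v vC; have : v \in lker f.
  apply: subvP vC; apply/span_subvP => u /mem_take; exact: vbasis_mem.
by rewrite memv_ker lfunE /= => /eqP.
Qed.

Lemma min_distance_exists C : (0 < \dim C)%N -> exists d, is_min_distance C d.
Proof.
rewrite lt0n dimv_eq0 => C0.
pose P c := (c \in C) && (c != 0).
have P0 : P (vpick C) by rewrite /P memv_pick vpick0.
case: (arg_minnP (@hamming_weight F n) P0) => c /andP[cC c0] cmin.
exists (hamming_weight c); split; first by exists c.
by move=> v vC v0; apply: cmin; rewrite /P vC.
Qed.

(** Equivalently, any at most [m] rows with distinct indices are linearly independent. *)
Definition min_relation_gt (r m : nat) (H : 'M[F]_(n, r)) : Prop :=
  forall v, v *m H = 0 -> (hamming_weight v <= m)%N -> v = 0.

Lemma hamming_weight_delta (i : 'I_n) :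
  hamming_weight (delta_mx 0 i : 'rV[F]_n) = 1%N.
Proof.
rewrite /hamming_weight -[RHS](cards1 i); congr #|pred_of_set _|.
apply/setP => j; rewrite !inE mxE eqxx /=.
by case: (eqVneq j i); rewrite ?oner_eq0 ?eqxx.
Qed.

Lemma hamming_weightB (u v : 'rV[F]_n) :
  (hamming_weight (u - v) <= hamming_weight u + hamming_weight v)%N.
Proof.
apply: leq_trans (leq_card_setU _ _); apply: subset_leq_card.
apply/subsetP => i; rewrite !inE !mxE; apply: contraR.
by rewrite negb_or !negbK => /andP[/eqP -> /eqP ->]; rewrite subr0.
Qed.

(** A zero row would be a relation with one term, a repeated row one with two terms. *)
Lemma min_relation_rows (r m : nat) (H : 'M[F]_(n, r)) : (1 < m)%N ->
  min_relation_gt m H -> (forall i, row i H != 0) /\ injective (fun i => row i H).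
Proof.
move=> m1 HH; split=> [i|i j /= eij].
  apply/eqP; rewrite rowE => /HH; rewrite hamming_weight_delta => /(_ (ltnW m1)).
  by move=> /rowP /(_ i); rewrite !mxE !eqxx => /eqP; rewrite oner_eq0.
have /HH : (delta_mx 0 i - delta_mx 0 j : 'rV[F]_n) *m H = 0.
  by rewrite mulmxBl -!rowE eij subrr.
have w2 := hamming_weightB (delta_mx 0 i) (delta_mx 0 j).
rewrite !hamming_weight_delta in w2.
move=> /(_ (leq_trans w2 m1)) /rowP /(_ i); rewrite !mxE !eqxx /=.
by case: eqP => // _ /eqP; rewrite subr0 oner_eq0.
Qed.

(** * From the rows of a matrix to an $S_h$-linear set, and back *)

Definition rows_with_zero (r : nat) (H : 'M[F]_(n, r)) : {set 'rV[F]_r} :=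
  0 |: [set row i H | i : 'I_n].

(** The zero vector contributes nothing, and distinct rows let the sum over vectors be reindexed by
    row numbers. *)
Lemma cval_rows_with_zero (r : nat) (H : 'M[F]_(n, r)) (c : 'rV[F]_r -> F) :
    (forall i, row i H != 0) -> injective (fun i => row i H) ->
    csupp c \subset rows_with_zero H ->
  cval c = (\row_i c (row i H)) *m H.
Proof.
move=> H0 Hi cA; rewrite /cval (bigID (mem (rows_with_zero H))) /=.
rewrite [X in _ + X]big1 => [|a aA]; last by rewrite (notin_csupp cA aA) scale0r.
rewrite addr0 big_setU1 /=; last first.
  by apply/imsetP => -[i _ E]; have := H0 i; rewrite -E eqxx.
rewrite scaler0 add0r big_imset /=; last by move=> i j _ _; apply: Hi.
by rewrite mulmx_sum_row; apply: eq_big => i; rewrite ?inE // mxE.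
Qed.

Lemma rows_with_zero_S_linear (r h : nat) (H : 'M[F]_(n, r)) : (0 < h <= n)%N ->
  min_relation_gt (2 * h) H ->
  S_linear_set h (rows_with_zero H) /\ #|rows_with_zero H| = n.+1.
Proof.
move=> /andP[h0 hn] HH; have [|H0 Hi] := min_relation_rows _ HH; first by lia.
have cA : #|rows_with_zero H| = n.+1.
  rewrite cardsU1 card_imset // card_ord.
  by case: imsetP => // -[i _ E]; have := H0 i; rewrite -E eqxx.
split=> //; split; first by rewrite cA; lia.
move=> s t cs ct nst est; apply: nst.
apply: (same_combination_of_coef cs ct) => a a0.
pose c b := coef_of_seq s b - coef_of_seq t b.
have [sA sh] := csupp_coef_of_seq cs; have [tA th] := csupp_coef_of_seq ct.
have cS : csupp c \subset csupp (coef_of_seq s) :|: csupp (coef_of_seq t).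
  apply/subsetP => b; rewrite !inE; apply: contraR.
  by rewrite negb_or !negbK /c => /andP[/eqP -> /eqP ->]; rewrite subr0.
have c_A : csupp c \subset rows_with_zero H.
  by apply: subset_trans cS _; rewrite subUset sA tA.
have cv : cval c = 0.
  have -> : cval c = cval (coef_of_seq s) - cval (coef_of_seq t).
    by rewrite /cval -sumrB; apply: eq_bigr => b _; rewrite scalerBl.
  by rewrite !cval_coef_of_seq est subrr.
have u0 : \row_i c (row i H) = 0.
  apply: HH; first by rewrite -cval_rows_with_zero.
  (* As the rows are distinct, the weight counts vectors in the support of [c], which has at most $h
     + h$ elements. *)
  have -> : hamming_weight (\row_i c (row i H)) =
      #|[set row i H | i in [set i | c (row i H) != 0]]|.
    rewrite card_imset //; congr #|pred_of_set _|.
    by apply/setP => i; rewrite !inE mxE.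
  have : (#|csupp c| <= 2 * h)%N.
    apply: leq_trans (subset_leq_card cS) _; apply: leq_trans (leq_card_setU _ _) _; lia.
  apply: leq_trans; apply: subset_leq_card; apply/subsetP => b /imsetP[i].
  by rewrite !inE => ci ->.
have [/setU1P[E|/imsetP[i _ ->]]|aA] := boolP (a \in rows_with_zero H).
- by rewrite E eqxx in a0.
- by move/rowP: u0 => /(_ i); rewrite !mxE => /eqP; rewrite subr_eq0 => /eqP.
- by rewrite (notin_csupp sA aA) (notin_csupp tA aA).
Qed.

Lemma S_linear_min_relation (r h : nat) (A : {set 'rV[F]_r}) :
    S_linear_set h A -> #|A| = n.+1 -> (2 * h <= n)%N ->
  exists H : 'M[F]_(n, r), min_relation_gt (2 * h) H.
Proof.
move=> SA cA hn; have [|b0 [b [b0A ind]]] := S_linear_shift_independent SA.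
  by rewrite cA ltnS.
have cn : #|A :\ b0| = n.
  by apply/eqP; rewrite -eqSS -cA (cardsD1 b0 A) b0A.
pose e (i : 'I_n) := enum_val (cast_ord (esym cn) i).
have ei : injective e by move=> i j /enum_val_inj /cast_ord_inj.
exists (\matrix_i (e i - b)) => v v0 vh.
(* At most one index contributes, [e] being injective; the sum extends [v] by zero to vectors
   outside the image of [e]. *)
pose c a := \sum_(i | e i == a) v 0 i.
have ce i : c (e i) = v 0 i.
  by rewrite /c (eq_bigl (pred1 i)) ?big_pred1_eq // => j; rewrite /= (inj_eq ei).
have cS : csupp c \subset [set e i | i in [set i | v 0 i != 0]].
  apply/subsetP => a; rewrite inE => ca.
  have [i /eqP E] : exists i, e i == a.
    apply/existsP; apply: contraNT ca; rewrite negb_exists => /forallP N.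
    by rewrite /c big_pred0 // => i; apply: negbTE.
  by rewrite -E ce in ca; rewrite -E; apply: imset_f; rewrite inE.
apply/rowP => i; rewrite mxE -ce; apply: ind.
- apply: subset_trans cS _; apply/subsetP => a /imsetP[j _ ->]; exact: enum_valP.
- apply: leq_trans (subset_leq_card cS) _.
  by apply: leq_trans (leq_imset_card _ _) vh.
- rewrite -[RHS]v0 mulmx_sum_row /c.
  under eq_bigr do rewrite scaler_suml.
  rewrite (exchange_big_dep xpredT) //=; apply: eq_bigr => j _.
  rewrite rowK (eq_bigl (pred1 (e j))) ?big_pred1_eq // => a.
Qed.

End Codes.

Local Close Scope ring_scope.

Theorem theorem3p15 (F : finFieldType) (h n k : nat)
  (h_gt0 : 0 < h) (n_gt0 : 0 < n) (k_gt0 : 0 < k) (hnk : 2 * h <= n - k) :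
  (exists (d : nat) (C : {vspace 'rV[F]_n}),
     linear_code k d C /\ 2 * h + 1 <= d)
  <->
  (exists A : {set 'rV[F]_(n - k)},
     S_linear_set h A /\ #|A| = n + 1).
Proof.
rewrite !addn1; split.
  move=> [d [C [[/parity_check_matrix[H HC] [_ Cd]] hd]]].
  exists (rows_with_zero H); apply: rows_with_zero_S_linear; first by lia.
  move=> v /HC vC vh; apply/eqP; apply: contraTT vh => v0.
  by have := Cd v vC v0; lia.
move=> [A [SA cA]].
have [|H HH] := S_linear_min_relation SA cA; first by lia.
(* Subtraction is truncated, but $n - k \geq 2h > 0$ forces $k < n$, hence $k + (n - k) = n$. *)
have [|C [dC HC]] := left_kernel_code H (k := k); first by lia.
have [|d dd] := @min_distance_exists _ _ C; first by rewrite dC.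
(* The minimum distance is the weight of a non-zero codeword, which is a relation between the rows
   of [H]. *)
exists d, C; split=> //; case: dd => -[c [cC c0 <-]] _.
rewrite ltnNge; apply: contra c0 => ch; apply/eqP; apply: HH ch; exact: HC.
Qed.
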